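(* One has $\sqrt n\,\|\hat p_n-p_0\|_\infty=O_p(1)$ as $n\to\infty$. Furthermore, if $p_0$ has finite support, then $$\sqrt n\,\|F_{\hat p_n}-F_{p_0}\|_\infty=O_p(1)\quad\text{and}\quad \sqrt n\,\|H_{\hat p_n}-H_{p_0}\|_\infty=O_p(1).$$
   Context: Let $\mathbb N=\{0,1,2,\dots\}$. For a real sequence $p$ and $k\ge1$ let $\Delta p(k)=p(k+1)-2p(k)+p(k-1)$; $p$ is convex if $\Delta p(k)\ge0$ for all $k\ge1$; $\mathcal C$ is the set of convex sequences with $\sum_kp(k)^2<\infty$; $\|p\|_\infty=\sup_k|p(k)|$. For a sequence $p$ define $F_p(k)=\sum_{j=0}^kp(j)$ for $k\in\mathbb N$ (with $F_p(-1)=0$) and $H_p(z)=\sum_{k=0}^{z-1}F_p(k)$ for $z\in\mathbb N$ (with $H_p(0)=0$). Let $p_0$ be a convex probability mass function on $\mathbb N$ whose support is either $\mathbb N$ or $\{0,\dots,S\}$ for some integer $S\ge1$. Let $X_1,X_2,\dots$ be i.i.d. with pmf $p_0$, $p_n(j)=\frac1n\sum_{i=1}^n\mathbb 1\{X_i=j\}$, and let $\hat p_n$ be the unique minimizer over $\mathcal C$ of $\frac12\sum_{j\in\mathbb N}(p_n(j)-p(j))^2$. *)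

(* Defs.v *)
From HB Require Import structures.
From mathcomp Require Import all_boot all_order all_algebra.
From mathcomp Require Import all_classical all_reals all_analysis.
Set Implicit Arguments. Unset Strict Implicit. Unset Printing Implicit Defensive.
Import Order.TTheory GRing.Theory Num.Theory.
Local Open Scope classical_set_scope.
Local Open Scope ring_scope.

Section Defs.
Context {R : realType}.

Definition Delta (p : nat -> R) (k : nat) : R := p k.+1 - 2 * p k + p k.-1.

Definition convex_seq (p : nat -> R) : Prop := forall k, (1 <= k)%N -> 0 <= Delta p k.

Definition in_C (p : nat -> R) : Prop :=
  convex_seq p /\ (\sum_(k <oo) ((p k) ^+ 2)%:E < +oo)%E.

Definition Fcdf (p : nat -> R) (k : nat) : R := \sum_(0 <= j < k.+1) p j.

Definition Hcum (p : nat -> R) (z : nat) : R := \sum_(0 <= k < z) Fcdf p k.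

Definition convex_pmf (p0 : nat -> R) : Prop :=
  (forall j, 0 <= p0 j) /\ (\sum_(j <oo) (p0 j)%:E = 1)%E /\ convex_seq p0 /\
  ((forall j, p0 j != 0) \/
   (exists S : nat, (1 <= S)%N /\ forall j, (p0 j != 0 <-> (j <= S)%N))).

(* empirical pmf based on X_1,...,X_n (indexed here 0,...,n-1) *)
Definition emp_pmf (T : Type) (X : nat -> T -> nat) (n : nat) (w : T) (j : nat) : R :=
  (\sum_(i < n) ((X i w == j)%:R : R)) / n%:R.

Definition lsq_crit (q p : nat -> R) : \bar R :=
  (2^-1)%:E * \sum_(j <oo) ((q j - p j) ^+ 2)%:E.

Definition is_lse (q ph : nat -> R) : Prop :=
  in_C ph /\ forall p, in_C p -> (lsq_crit q ph <= lsq_crit q p)%E.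

Definition iid_pmf d (T : measurableType d) (P : probability T R)
  (X : nat -> T -> nat) (p0 : nat -> R) : Prop :=
  (forall i j, measurable (X i @^-1` [set j])) /\
  forall (I : seq nat) (v : nat -> nat), uniq I ->
    P [set w | forall i, i \in I -> X i w = v i] = (\prod_(i <- I) p0 (v i))%:E.

(* sup_k |Z n w k| = O_p(1), with outer probability:
   for every eps > 0 there are M and N such that for all n >= N the event
   {sup_k |Z n w k| > M} is contained in a measurable set of probability <= eps. *)
Definition Op1_sup d (T : measurableType d) (P : probability T R)
  (Z : nat -> T -> nat -> R) : Prop :=
  forall eps : R, 0 < eps -> exists M : R, exists N : nat, forall n, (N <= n)%N ->
    exists A : set T, measurable A /\
      [set w | exists k, M < `|Z n w k|] `<=` A /\ (P A <= eps%:E)%E.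

End Defs.

(* Main.v *)
(* Since p0 is itself a competitor, |phat - p0| is at most twice the l2 distance
   between the empirical pmf p_n and p0, whose squared expectation is at most
   1/n; the first claim is Markov's inequality.
   If p0 is supported in {0..S}, then phat must be the positive part of an affine
   function beyond S - 1: otherwise truncating it linearly would improve the fit.
   Its slope is close to p0(S - 1) - p0(S) >= p0(S) > 0, so phat vanishes from
   S + 3 on, with probability close to 1; this bounds F_phat - F_p0. For H one also
   needs that phat has total mass exactly 1, which follows by perturbing phat along
   the tents k |-> (m - k)_+. *)
Require Import Defs.
From HB Require Import structures.
From mathcomp Require Import all_boot all_order all_algebra.
From mathcomp Require Import all_classical all_reals all_analysis.
From mathcomp Require Import measurable_realfun.
From mathcomp Require Import ring lra zify.
Set Implicit Arguments.
Unset Strict Implicit.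
Unset Printing Implicit Defensive.
Import Order.TTheory GRing.Theory Num.Theory.
Local Open Scope classical_set_scope.
Local Open Scope ring_scope.

(** * Series with nonnegative terms *)

Section Series.
Context {R : realType}.
Implicit Types f g u q p : nat -> R.

Lemma nneseries_EFin_ge0 f N : (forall k, 0 <= f k) ->
  (0 <= \sum_(N <= k <oo) (f k)%:E)%E.
Proof. by move=> f0; apply: nneseries_ge0 => k _ _; rewrite lee_fin. Qed.

Lemma le_nneseries_EFin f g : (forall k, 0 <= f k <= g k) ->
  (\sum_(k <oo) (f k)%:E <= \sum_(k <oo) (g k)%:E)%E.
Proof.
by move=> fg; apply: lee_nneseries => k *; rewrite lee_fin; case/andP: (fg k).
Qed.

Lemma nneseries_EFin_partial_le f N : (forall k, 0 <= f k) ->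
  ((\sum_(0 <= k < N) f k)%:E <= \sum_(k <oo) (f k)%:E)%E.
Proof.
by move=> f0; rewrite -sumEFin; apply: nneseries_lim_ge => k *; rewrite lee_fin.
Qed.

Lemma nneseries_EFin_term_le f k : (forall k, 0 <= f k) ->
  ((f k)%:E <= \sum_(k <oo) (f k)%:E)%E.
Proof.
move=> f0; apply: le_trans (nneseries_EFin_partial_le k.+1 f0).
by rewrite lee_fin big_nat_recr//= lerDr sumr_ge0.
Qed.

Lemma nneseries_finsupp_lty f N : (forall k, 0 <= f k) ->
  (forall k, (N <= k)%N -> f k = 0) -> (\sum_(k <oo) (f k)%:E < +oo)%E.
Proof.
move=> f0 fN; rewrite (nneseries_split 0 N); last by move=> k _; rewrite lee_fin.
rewrite add0n eseries0 ?adde0; last by move=> k Nk _; rewrite fN.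
by rewrite sumEFin ltry.
Qed.

(** Writing g = f + (g - f), finiteness of the sum of [f] lets it be cancelled; the nonnegative
    series of g - f then has sum at most 0, so each term is 0. *)
Lemma nneseries_pointwise_eq f g : (forall k, 0 <= f k <= g k) ->
  (\sum_(k <oo) (g k)%:E <= \sum_(k <oo) (f k)%:E)%E ->
  (\sum_(k <oo) (f k)%:E < +oo)%E -> f =1 g.
Proof.
move=> fg gf foo k.
have f0 j : 0 <= f j by case/andP: (fg j).
have d0 j : 0 <= g j - f j by rewrite subr_ge0; case/andP: (fg j).
have gE : (\sum_(k <oo) (g k)%:E = \sum_(k <oo) (f k)%:E + \sum_(k <oo) (g k - f k)%:E)%E.
  rewrite -nneseriesD; try by move=> j *; rewrite lee_fin.
  by apply: eq_eseriesr => j _; rewrite -EFinD addrC subrK.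
have ffin : (\sum_(k <oo) (f k)%:E)%E \is a fin_num.
  by rewrite ge0_fin_numE// nneseries_EFin_ge0.
have /(le_trans (nneseries_EFin_term_le k d0)) : 
    (\sum_(k <oo) (g k - f k)%:E <= 0)%E.
  by rewrite -(leeD2lE _ _ ffin) adde0 -gE.
by rewrite lee_fin => H; apply/eqP; rewrite -subr_eq0 -oppr_eq0 opprB eq_le H d0.
Qed.

Lemma nneseries_sqrB_lty q p :
  (\sum_(k <oo) (q k ^+ 2)%:E < +oo)%E -> (\sum_(k <oo) (p k ^+ 2)%:E < +oo)%E ->
  (\sum_(k <oo) ((q k - p k) ^+ 2)%:E < +oo)%E.
Proof.
move=> qoo poo.
apply: (@le_lt_trans _ _ (\sum_(k <oo) (2%:E * (q k ^+ 2)%:E + 2%:E * (p k ^+ 2)%:E))%E).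
  apply: lee_nneseries => k *; first by rewrite lee_fin sqr_ge0.
  rewrite -!EFinM -EFinD lee_fin.
  (* (q - p)^2 + (q + p)^2 = 2 q^2 + 2 p^2. *)
  by have := sqr_ge0 (q k + p k); rewrite sqrrB sqrrD; lra.
rewrite nneseriesD; try by move=> k *; rewrite -EFinM lee_fin mulr_ge0// sqr_ge0.
rewrite !nneseriesZl; try by move=> k *; rewrite lee_fin sqr_ge0.
by rewrite lte_add_pinfty// lte_mul_pinfty// lee_fin.
Qed.

Lemma nneseries_eventually_ge_pinfty f (c : R) N : (forall k, 0 <= f k) -> 0 < c ->
  (forall k, (N <= k)%N -> c <= f k) -> (\sum_(k <oo) (f k)%:E = +oo)%E.
Proof.
move=> f0 c0 fc; apply/eqyP => A A0.
pose m := (Num.trunc (A / c)).+1.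
apply: le_trans (nneseries_EFin_partial_le (N + m) f0); rewrite lee_fin.
rewrite (big_cat_nat (n := N)) ?leq_addr//=.
rewrite ler_wpDl ?sumr_ge0//.
apply: (@le_trans _ _ (\sum_(N <= k < N + m) c)).
  rewrite big_const_nat iter_addr_0 addKn -mulr_natr mulrC -ler_pdivrMr//.
  by rewrite ltW// truncnS_gt.
by rewrite !big_nat; apply: ler_sum => k /andP[Nk _]; exact: fc.
Qed.

End Series.

(** * Square-summable convex sequences and optimality of the least-squares fit *)

Section ConvexLse.
Context {R : realType}.
Implicit Types p q ph h : nat -> R.

Lemma in_C_sqr_not_bounded_below p (c : R) N : in_C p -> 0 < c ->
  ~ (forall k, (N <= k)%N -> c <= p k ^+ 2).
Proof.
move=> [_ poo] c0 pc; move: poo.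
by rewrite (nneseries_eventually_ge_pinfty (N := N) _ c0)// => k; exact: sqr_ge0.
Qed.

Lemma convex_slope_le p k j : convex_seq p ->
  p k.+1 - p k <= p (k + j).+1 - p (k + j)%N.
Proof.
move=> cp; elim: j => [|j IH]; first by rewrite addn0.
have := cp (k + j).+1 isT; rewrite /Delta /= addnS; lra.
Qed.

Lemma convex_above_chord p k j : convex_seq p ->
  p k + j%:R * (p k.+1 - p k) <= p (k + j)%N.
Proof.
move=> cp; elim: j => [|j IH]; first by rewrite mul0r addr0 addn0.
have := convex_slope_le k j cp; rewrite addnS -natr1 mulrDl mul1r; lra.
Qed.

(** By convexity one strict increase persists as a slope, and the resulting linear growth
    contradicts square-summability. *)
Lemma in_C_nonincreasing p k : in_C p -> p k.+1 <= p k.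
Proof.
move=> Cp; rewrite leNgt; apply/negP => pk.
have d0 : 0 < p k.+1 - p k by rewrite subr_gt0.
(* After [m] steps of the slope at [k] the sequence has risen by at least 1 + |p k|, hence lies
   above 1. *)
pose m := (Num.trunc ((1 + `|p k|) / (p k.+1 - p k))).+1.
apply: (@in_C_sqr_not_bounded_below p 1 (k + m)%N Cp ltr01) => i kmi.
have mi : (m <= i - k)%N by rewrite leq_subRL// (leq_trans (leq_addr _ _) kmi).
have := convex_above_chord k (i - k) Cp.1.
rewrite subnKC; last by rewrite (leq_trans (leq_addr _ _) kmi).
have : 1 + `|p k| <= (i - k)%:R * (p k.+1 - p k).
  rewrite -ler_pdivrMr// (le_trans (ltW (truncnS_gt _)))// ler_nat//.
have := ler_norm (- p k); rewrite normrN => ? ? ?.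
have : 1 <= p i by lra.
by move=> p1; rewrite -[leLHS](expr1n _ 2) lerXn2r// nnegrE; lra.
Qed.

Lemma in_C_nonincreasing_le p j k : in_C p -> (j <= k)%N -> p k <= p j.
Proof.
move=> Cp /subnKC <-; elim: (k - j)%N => [|i IH]; first by rewrite addn0.
by rewrite addnS (le_trans (in_C_nonincreasing _ Cp)).
Qed.

(** By monotonicity the sequence would stay below a negative value, keeping its squares away from
    0. *)
Lemma in_C_ge0 p k : in_C p -> 0 <= p k.
Proof.
move=> Cp; rewrite leNgt; apply/negP => pk.
apply: (@in_C_sqr_not_bounded_below p (p k ^+ 2) k Cp) => [|i ki].
  by rewrite exprn_even_gt0//= lt_eqF.
have := in_C_nonincreasing_le Cp ki; nra.
Qed.

(** For [p] in the class and S >= 1, this is the smallest nonnegative convex sequence agreeing with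
    [p] up to [S]. *)
Definition linear_truncation p S k : R :=
  if (k <= S)%N then p k
  else Num.max 0 (p S - (k - S)%:R * (p S.-1 - p S)).

Lemma linear_truncation_bounds p S k : in_C p -> (0 < S)%N ->
  0 <= linear_truncation p S k <= p k.
Proof.
move=> Cp S0; rewrite /linear_truncation; case: leqP => kS.
  by rewrite in_C_ge0//= lexx.
rewrite le_max lexx/= ge_max in_C_ge0//=.
have := convex_above_chord S.-1 (k - S.-1) Cp.1.
rewrite subnKC ?(leq_trans (leq_pred _) (ltnW kS))// prednK//.
have -> : (k - S.-1 = (k - S).+1)%N by lia.
by rewrite -natr1; lra.
Qed.

Lemma linear_truncation_tail p S j : in_C p ->
  linear_truncation p S (S + j) = Num.max 0 (p S - j%:R * (p S.-1 - p S)).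
Proof.
move=> Cp; rewrite /linear_truncation addKn -{2}(addn0 S) leq_add2l leqn0.
by case: eqP => [->|//]; rewrite addn0 mul0r subr0 max_r// in_C_ge0.
Qed.

Lemma linear_truncation_in_C p S : in_C p -> (0 < S)%N ->
  in_C (linear_truncation p S).
Proof.
move=> Cp S0; split; last first.
  apply: le_lt_trans Cp.2; apply: le_nneseries_EFin => k.
  have /andP[t0 tp] := linear_truncation_bounds k Cp S0.
  by rewrite sqr_ge0/= lerXn2r// nnegrE// in_C_ge0.
(* Below [S] the second difference is that of [p]. Beyond [S] the sequence is the maximum of 0 and
   an affine function. At [S] it lies above the line through the last two values, whose second
   difference is 0. *)
move=> k k1; have [kS|Sk|kS] := ltngtP k S.
- rewrite /Delta /linear_truncation kS (ltnW kS) (leq_trans (leq_pred k) (ltnW kS)).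
  exact: Cp.1.
- rewrite -(subnKC Sk); move: (k - S.+1)%N => i.
  rewrite /Delta addSn /= -!addnS !linear_truncation_tail//.
  rewrite -[i.+2%:R]natr1 -[i.+1%:R]natr1.
  rewrite !mulrDl !mul1r; set d := _ - p S; set y := i%:R * d.
  have [] := leP 0 (p S - y); have [] := leP 0 (p S - (y + d));
    have [] := leP 0 (p S - (y + d + d)); lra.
- rewrite kS /Delta -addn1 linear_truncation_tail// /linear_truncation leqnn leq_pred.
  rewrite mul1r.
  have : p S - (p S.-1 - p S) <= Num.max 0 (p S - (p S.-1 - p S)).
    by rewrite le_max lexx orbT.
  lra.
Qed.

Lemma lse_sum_le q ph p : is_lse q ph -> in_C p ->
  (\sum_(j <oo) ((q j - ph j) ^+ 2)%:E <= \sum_(j <oo) ((q j - p j) ^+ 2)%:E)%E.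
Proof.
by move=> [_ H] /H; rewrite /lsq_crit lee_pmul2l// lte_fin invr_gt0.
Qed.

(* Where the data vanish, lowering a nonnegative fit improves it. *)
Lemma lse_linear_tail q ph S j : is_lse q ph -> (0 < S)%N ->
  (forall k, (S < k)%N -> q k = 0) ->
  ph (S + j)%N = Num.max 0 (ph S - j%:R * (ph S.-1 - ph S)).
Proof.
move=> lse S0 qS; have Cph := lse.1.
rewrite -linear_truncation_tail//.
pose t := linear_truncation ph S.
have Ct : in_C t by exact: linear_truncation_in_C.
have tph k : 0 <= t k <= ph k by exact: linear_truncation_bounds.
have le_sq k : 0 <= (q k - t k) ^+ 2 <= (q k - ph k) ^+ 2.
  rewrite sqr_ge0/=; have [kS|Sk] := leqP k S.
    by rewrite /t /linear_truncation kS.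
  rewrite qS// !sub0r !sqrrN; case/andP: (tph k) => t0 tp.
  by rewrite lerXn2r// nnegrE in_C_ge0.
have qoo : (\sum_(k <oo) (q k ^+ 2)%:E < +oo)%E.
  apply: (@nneseries_finsupp_lty _ _ S.+1) => k; first exact: sqr_ge0.
  by move=> Sk; rewrite qS// expr0n.
(* The truncation is nowhere a worse fit and [ph] is optimal, so the squared errors agree term by
   term. *)
have /(_ (S + j)%N) := nneseries_pointwise_eq le_sq (lse_sum_le lse Ct)
  (nneseries_sqrB_lty qoo Ct.2).
case: (posnP j) => [->|j0].
  by rewrite addn0 /linear_truncation leqnn.
have Sj : (S < S + j)%N by rewrite -{1}(addn0 S) ltn_add2l.
rewrite qS// !sub0r !sqrrN => /eqP; rewrite eqrXn2// ?in_C_ge0//.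
by rewrite eq_sym => /eqP.
Qed.

(** Divide by t and let t tend to 0. *)
Lemma quadratic_max_at0 (a b c : R) : 0 < c ->
  (forall t, 0 <= t <= c -> 2 * t * a <= t ^+ 2 * b) -> a <= 0.
Proof.
move=> c0 H; rewrite leNgt; apply/negP => a0.
have b0 : 0 < `|b| + 1 by rewrite ltr_wpDl.
(* Small enough that t |b| < a, whereas the hypothesis would give 2 a <= t b. *)
pose t := Num.min c (a / (`|b| + 1)).
have t0 : 0 < t by rewrite lt_min c0 divr_gt0.
have tc : t <= c by rewrite ge_min lexx.
have tb : t * (`|b| + 1) <= a by rewrite -ler_pdivlMr// ge_min lexx orbT.
have /H : 0 <= t <= c by rewrite ltW.
rewrite expr2 -mulrA (mulrC 2) -!mulrA ler_pM2l// => ab.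
have := ler_norm b; nra.
Qed.

(** First-order optimality: the one-sided derivative of the criterion along an admissible direction
    [h] of finite support is nonnegative. *)
Lemma lse_variation q ph h N (c : R) : is_lse q ph ->
  (\sum_(k <oo) (q k ^+ 2)%:E < +oo)%E ->
  (forall k, (N <= k)%N -> h k = 0) -> 0 < c ->
  (forall t, 0 <= t <= c -> in_C (fun k => ph k + t * h k)) ->
  \sum_(0 <= k < N) (q k - ph k) * h k <= 0.
Proof.
move=> lse qoo hN c0 Ch.
apply: (@quadratic_max_at0 _ (\sum_(0 <= k < N) h k ^+ 2) c c0) => t /Ch Ct.
have := lse_sum_le lse Ct.
(* Only the terms below [N] depend on t; the common tail is finite and cancels. *)
have split u : (\sum_(k <oo) ((q k - u k) ^+ 2)%:E =
    (\sum_(0 <= k < N) (q k - u k) ^+ 2)%:E +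
    \sum_(N <= k <oo) ((q k - u k) ^+ 2)%:E)%E.
  rewrite (nneseries_split 0 N) ?add0n ?sumEFin// => k _.
  by rewrite lee_fin sqr_ge0.
have tailfin : (\sum_(N <= k <oo) ((q k - ph k) ^+ 2)%:E \is a fin_num)%E.
  rewrite ge0_fin_numE; last by apply: nneseries_EFin_ge0 => k; exact: sqr_ge0.
  apply: le_lt_trans (nneseries_sqrB_lty qoo lse.1.2).
  rewrite split leeDr// lee_fin sumr_ge0// => k _; exact: sqr_ge0.
rewrite !split.
have -> : (\sum_(N <= k <oo) ((q k - (ph k + t * h k)) ^+ 2)%:E =
           \sum_(N <= k <oo) ((q k - ph k) ^+ 2)%:E)%E.
  rewrite [LHS]eseries_cond [RHS]eseries_cond.
  by apply: eq_eseriesr => k /= Nk; rewrite hN// mulr0 addr0.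
rewrite leeD2rE// lee_fin -subr_ge0 -sumrB => H.
rewrite -subr_ge0 !mulr_sumr -sumrB; apply: le_trans H _.
by rewrite le_eqVlt; apply/orP; left; apply/eqP; apply: eq_bigr => k _; ring.
Qed.

End ConvexLse.

(** * Tent perturbations, total mass, and the deterministic bounds for finite support *)

Section FiniteSupport.
Context {R : realType}.
Implicit Types p q ph r : nat -> R.

Lemma FcdfB p q k : Fcdf (fun j => p j - q j) k = Fcdf p k - Fcdf q k.
Proof. by rewrite /Fcdf sumrB. Qed.

Lemma HcumB p q z : Hcum (fun j => p j - q j) z = Hcum p z - Hcum q z.
Proof. by rewrite /Hcum -sumrB; apply: eq_bigr => k _; rewrite FcdfB. Qed.

Lemma FcdfS p k : Fcdf p k.+1 = Fcdf p k + p k.+1.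
Proof. by rewrite /Fcdf big_nat_recr. Qed.

Lemma HcumS p z : Hcum p z.+1 = Hcum p z + Fcdf p z.
Proof. by rewrite /Hcum big_nat_recr. Qed.

Lemma Fcdf_eventually_cst p K k : (forall j, (K < j)%N -> p j = 0) ->
  (K <= k)%N -> Fcdf p k = Fcdf p K.
Proof.
move=> pK /subnKC <-; elim: (k - K)%N => [|i IH]; first by rewrite addn0.
by rewrite addnS FcdfS IH pK ?addr0// ltnS leq_addr.
Qed.

(** Summation by parts: p(j) is counted once for each k with j <= k < m. Optimality along tents thus
    becomes a statement about [Hcum]. *)
Lemma Hcum_tentE p m : Hcum p m = \sum_(0 <= j < m) p j * (m - j)%:R.
Proof.
elim: m => [|m IH]; first by rewrite /Hcum !big_geq.
rewrite HcumS IH /Fcdf big_nat_recr// [RHS]big_nat_recr//= subSnn mulr1 addrA.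
congr (_ + _); rewrite -big_split/= !big_nat; apply: eq_bigr => j /andP[_ jm].
by rewrite subSn ?(ltnW jm)// -natr1 mulrDr mulr1.
Qed.

(** Truncated subtraction makes [m - j] a tent, whose only kink is at [m]. *)
Lemma Delta_tent m k : (0 < k)%N ->
  Delta (fun j => (m - j)%:R : R) k = (k == m)%:R.
Proof.
case: k => // k _; rewrite /Delta /=.
have [km|mk|<-] := ltngtP k.+1 m.
- have -> : (m - k = (m - k.+2).+2)%N by lia.
  have -> : (m - k.+1 = (m - k.+2).+1)%N by lia.
  move: (m - k.+2)%N => i; rewrite -[i.+2%:R]natr1 -[i.+1%:R]natr1 mulr0n; lra.
- have -> : (m - k = 0)%N by lia.
  have -> : (m - k.+1 = 0)%N by lia.
  have -> : (m - k.+2 = 0)%N by lia.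
  rewrite mulr0n; lra.
- have -> : (k.+1 - k.+2 = 0)%N by lia.
  rewrite subnn subSnn mulr0n mulr1n; lra.
Qed.

(** Only the second difference at [m] changes, by [t], which may be negative. For m = 0 the tent is
    identically 0, hence the guard. *)
Lemma in_C_add_tent ph m (t : R) : in_C ph ->
  ((0 < m)%N -> 0 <= Delta ph m + t) ->
  in_C (fun k => ph k + t * (m - k)%:R).
Proof.
move=> Cph H; split.
  move=> k k0.
  have -> : Delta (fun k => ph k + t * (m - k)%:R) k =
      Delta ph k + t * Delta (fun j => (m - j)%:R) k by rewrite /Delta; ring.
  rewrite Delta_tent//; case: eqP => [km|_].
    by rewrite km mulr1 H// -km.
  by rewrite mulr0 addr0; exact: Cph.1.
have : (\sum_(k <oo) ((- t * (m - k)%:R) ^+ 2)%:E < +oo)%E.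
  apply: (@nneseries_finsupp_lty _ _ m) => k; first exact: sqr_ge0.
  by rewrite -subn_eq0 => /eqP ->; rewrite mulr0 expr0n.
move=> /(nneseries_sqrB_lty Cph.2); congr (_ < _)%E.
by apply: eq_eseriesr => k _; rewrite mulNr opprK.
Qed.

(** The tent is convex, so adding any nonnegative multiple of it to [ph] is admissible. *)
Lemma lse_Hcum_le q ph m : is_lse q ph ->
  (\sum_(k <oo) (q k ^+ 2)%:E < +oo)%E ->
  Hcum (fun j => q j - ph j) m <= 0.
Proof.
move=> lse qoo; rewrite Hcum_tentE.
apply: (@lse_variation _ q ph (fun k => (m - k)%:R) m 1) => // [k|t /andP[t0 _]].
  by rewrite -subn_eq0 => /eqP ->.
by apply: in_C_add_tent lse.1 _ => m0; rewrite addr_ge0// lse.1.1.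
Qed.

(** A strict kink leaves room to subtract the tent as well, up to the multiple [Delta ph m]. *)
Lemma lse_Hcum_ge_at_kink q ph m : is_lse q ph ->
  (\sum_(k <oo) (q k ^+ 2)%:E < +oo)%E -> 0 < Delta ph m ->
  0 <= Hcum (fun j => q j - ph j) m.
Proof.
move=> lse qoo kink; rewrite Hcum_tentE -oppr_le0 -sumrN.
under eq_bigr do rewrite -mulrN.
apply: (@lse_variation _ q ph (fun k => - (m - k)%:R) m _ lse qoo _ kink) => [k|].
  by rewrite -subn_eq0 => /eqP ->; rewrite oppr0.
move=> t /andP[_ tm].
have -> : (fun k => ph k + t * - (m - k)%:R) = (fun k => ph k + - t * (m - k)%:R).
  by apply/funext => k; rewrite mulrN mulNr.
by apply: in_C_add_tent lse.1 _ => m0; rewrite subr_ge0.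
Qed.

(* The excess mass is the asymptotic slope of the nonpositive function
   [Hcum (q - ph)], hence at most 0; it is nonnegative because
   [Hcum (q - ph)] vanishes at the last kink of [ph]. *)
Lemma lse_mass q ph K : is_lse q ph -> (forall j, 0 <= q j) ->
  (forall j, (K < j)%N -> q j = 0) -> (forall j, (K < j)%N -> ph j = 0) ->
  0 < ph 0%N -> Fcdf ph K = Fcdf q K.
Proof.
move=> lse q0 qK phK ph0.
have qoo : (\sum_(k <oo) (q k ^+ 2)%:E < +oo)%E.
  apply: (@nneseries_finsupp_lty _ _ K.+1) => k; first exact: sqr_ge0.
  by move=> Sk; rewrite qK// expr0n.
set r := fun j => q j - ph j.
have rK j : (K < j)%N -> r j = 0 by move=> Kj; rewrite /r qK// phK// subr0.
have Hr m : Hcum r m <= 0 by exact: lse_Hcum_le.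
suff : Fcdf r K = 0 by rewrite FcdfB => /eqP; rewrite subr_eq0 => /eqP.
apply/eqP; rewrite eq_le; apply/andP; split.
- have Hlin i : Hcum r (K + i) = Hcum r K + i%:R * Fcdf r K.
    elim: i => [|i IH]; first by rewrite addn0 mul0r addr0.
    rewrite addnS HcumS IH (Fcdf_eventually_cst rK) ?leq_addr// -natr1.
    by rewrite mulrDl mul1r addrA.
  rewrite leNgt; apply/negP => c0.
  (* An index so far out that a positive slope would make [Hcum r] positive. *)
  have := Hr (K + (Num.trunc (- Hcum r K / Fcdf r K)).+1)%N.
  have := truncnS_gt (- Hcum r K / Fcdf r K).
  by rewrite Hlin ltr_pdivrMr//; lra.
- have exz : exists m, ph m == 0 by exists K.+1; rewrite phK.
  (* The first zero of [ph] is [m.+1]; its second difference there is ph(m) > 0. *)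
  case: (ex_minnP exz) => -[|m] /eqP phm minm; first by rewrite phm ltxx in ph0.
  have phm0 : 0 < ph m.
    by rewrite lt_def (in_C_ge0 _ lse.1) andbT; apply: contraT => /negPn /minm; rewrite ltnn.
  have phz j : (m < j)%N -> ph j = 0.
    move=> mj; apply/eqP; rewrite eq_le (in_C_ge0 _ lse.1) andbT -phm.
    exact: in_C_nonincreasing_le lse.1 _.
  have kink : 0 < Delta ph m.+1 by rewrite /Delta phm phz//=; lra.
  have := lse_Hcum_ge_at_kink lse qoo kink; rewrite -/r HcumS => Hm.
  have Fm : 0 <= Fcdf r m by have := Hr m; lra.
  have -> : Fcdf r K = Fcdf r (m + K).
    by rewrite [RHS](Fcdf_eventually_cst rK)// leq_addl.
  (* Beyond [m] the difference [r] equals [q], so [Fcdf r] can only increase from its nonnegative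
     value at [m]. *)
  elim: K {exz phK qK rK} => [|i IH]; first by rewrite addn0.
  by rewrite addnS FcdfS addr_ge0// /r phz ?subr0// ltnS leq_addr.
Qed.

(** When [ph] is uniformly close to [p0], both vanish from S + 3 on and have equal mass, so only
    boundedly many errors of size [delta] accumulate. *)
Lemma finite_support_stability p0 q ph S (delta : R) :
  is_lse q ph -> convex_seq p0 -> (0 < S)%N -> 0 < p0 S ->
  (forall j, (S < j)%N -> p0 j = 0) ->
  (forall j, 0 <= q j) -> (forall j, (S < j)%N -> q j = 0) ->
  Fcdf q S = Fcdf p0 S ->
  (forall k, `|ph k - p0 k| <= delta) -> delta <= p0 S / 4 ->
  (forall k, `|Fcdf ph k - Fcdf p0 k| <= (S + 3)%:R * delta) /\
  (forall z, `|Hcum ph z - Hcum p0 z| <= (S + 3)%:R * ((S + 3)%:R * delta)).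
Proof.
move=> lse cp0 S0 p0S p0z q0 qz qp0 close small.
have bnd k : p0 k - delta <= ph k <= p0 k + delta.
  by have := close k; rewrite ler_distl.
have delta0 : 0 <= delta by apply: le_trans (close 0%N).
(* Convexity at [S] gives p0(S - 1) >= 2 p0(S). Hence the affine tail at S + 3, 4 ph(S) - 3 ph(S -
   1), is at most 7 delta - 2 p0(S), negative since delta <= p0(S) / 4. *)
have ph_zero3 : ph (S + 3)%N = 0.
  rewrite (lse_linear_tail 3 lse S0 qz) max_l//.
  have /andP[_ ?] := bnd S; have /andP[? _] := bnd S.-1.
  have := cp0 S S0; rewrite /Delta p0z// => ?.
  by rewrite mulrBr; lra.
have phz j : (S + 2 < j)%N -> ph j = 0.
  rewrite -addnS => Sj; apply/eqP; rewrite eq_le (in_C_ge0 _ lse.1) andbT -ph_zero3.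
  exact: in_C_nonincreasing_le lse.1 _.
have ph0 : 0 < ph 0%N.
  apply: lt_le_trans (in_C_nonincreasing_le lse.1 (leq0n S)).
  have /andP[+ _] := bnd S; lra.
have qz2 j : (S + 2 < j)%N -> q j = 0 by move=> Sj; rewrite qz//; lia.
have p0z2 j : (S + 2 < j)%N -> p0 j = 0 by move=> Sj; rewrite p0z//; lia.
have mass := lse_mass lse q0 qz2 phz ph0.
have FE k : (S + 2 <= k)%N -> Fcdf ph k = Fcdf p0 k.
  move=> Sk; rewrite (Fcdf_eventually_cst phz)// mass.
  rewrite (Fcdf_eventually_cst qz) ?leq_addr// qp0.
  by rewrite (Fcdf_eventually_cst p0z)//; lia.
have Fb k : `|Fcdf ph k - Fcdf p0 k| <= (S + 3)%:R * delta.
  have [/FE ->|kS] := leqP (S + 2) k.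
    by rewrite subrr normr0 mulr_ge0.
  rewrite -FcdfB /Fcdf; apply: le_trans (ler_norm_sum _ _ _) _.
  apply: (@le_trans _ _ (\sum_(0 <= j < k.+1) delta)).
    by apply: ler_sum => j _; exact: close.
  rewrite big_const_nat iter_addr_0 subn0 -[leLHS]mulr_natl ler_wpM2r// ler_nat.
  lia.
split=> // z; rewrite -HcumB /Hcum.
(* The distribution functions agree from S + 2 on, so the bound does not depend on [z]. *)
apply: (@le_trans _ _ (\sum_(0 <= k < z) (if (k < S + 3)%N then (S + 3)%:R * delta else 0))).
  apply: le_trans (ler_norm_sum _ _ _) _; apply: ler_sum => k _; rewrite FcdfB.
  case: ifPn => [_ //|kS]; rewrite FE ?subrr ?normr0//; lia.
rewrite -big_mkcond/= big_const_seq iter_addr_0 -[leLHS]mulr_natl.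
rewrite ler_wpM2r ?mulr_ge0// ler_nat -size_filter.
rewrite -[leqRHS](size_iota 0); apply: uniq_leq_size.
  by rewrite filter_uniq// iota_uniq.
by move=> k; rewrite mem_filter mem_iota => /andP[].
Qed.

End FiniteSupport.

(** * Second moments of the empirical pmf and Markov's inequality *)

Section EmpiricalPmf.
Context {R : realType} {d : measure_display} {T : measurableType d}.
Variables (P : probability T R) (X : nat -> T -> nat) (p0 : nat -> R).
Hypothesis iidX : iid_pmf P X p0.

Let measurable_atom i j : measurable (X i @^-1` [set j]).
Proof. exact: iidX.1. Qed.

Lemma iid_pmf_atom i j : P (X i @^-1` [set j]) = (p0 j)%:E.
Proof.
have -> : p0 j = \prod_(k <- [:: i]) p0 j by rewrite big_seq1.
rewrite -(iidX.2 [:: i] (fun=> j))//.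
congr (P _); apply/seteqP; split=> w /=.
  by move=> wj k; rewrite inE => /eqP ->.
by apply; rewrite inE.
Qed.

(** Pairwise independence, as needed for the second moment of the counts. *)
Lemma iid_pmf_atom2 i l j : i != l ->
  P (X i @^-1` [set j] `&` X l @^-1` [set j]) = (p0 j ^+ 2)%:E.
Proof.
move=> il; have -> : p0 j ^+ 2 = \prod_(k <- [:: i; l]) p0 j.
  by rewrite big_cons big_seq1 expr2.
rewrite -(iidX.2 [:: i; l] (fun=> j)); last by rewrite /= inE il.
congr (P _); apply/seteqP; split=> w /=.
  by move=> [wi wl] k; rewrite !inE => /orP[] /eqP ->.
by move=> H; split; apply: H; rewrite !inE eqxx ?orbT.
Qed.

Let ind i j w : R := (X i w == j)%:R.

Let indE i j : ind i j = \1_(X i @^-1` [set j]).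
Proof.
apply/funext => w; rewrite indicE /ind; congr (_%:R); congr nat_of_bool.
by apply/eqP/idP; rewrite inE.
Qed.

Let measurable_ind i j : measurable_fun setT (ind i j).
Proof. by rewrite indE; exact: measurable_indic. Qed.

Let measurable_dev n j :
  measurable_fun setT (fun w => emp_pmf X n w j - p0 j : R).
Proof.
apply: measurable_funB => //; apply: measurable_funM => //.
by apply: measurable_sum => i; exact: measurable_ind.
Qed.

Let count n j w := \sum_(i < n) ind i j w.

Let integral_sqr_count n j :
  (\int[P]_w (count n j w ^+ 2)%:E <=
    (n%:R * p0 j + n%:R ^+ 2 * p0 j ^+ 2)%:E)%E.
Proof.
have -> : (\int[P]_w (count n j w ^+ 2)%:E =
   \int[P]_w (\sum_(i < n) \sum_(l < n)
     (\1_(X i @^-1` [set j] `&` X l @^-1` [set j]) w)%:E))%E.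
  apply: eq_integral => w _; rewrite expr2 /count big_distrlr /=.
  rewrite -sumEFin; apply: eq_bigr => i _; rewrite -sumEFin.
  by apply: eq_bigr => l _; rewrite !indE indicI.
rewrite ge0_integral_sum//; last 2 first.
- move=> i; apply: emeasurable_sum => l; apply/measurable_EFinP.
  by apply: measurable_indic; exact: measurableI.
- by move=> i w _; apply: sume_ge0 => l _; rewrite lee_fin.
apply: (@le_trans _ _ (\sum_(i < n) (p0 j + n%:R * p0 j ^+ 2)%:E)%E).
  apply: lee_sum => i _; rewrite ge0_integral_sum//; last first.
    move=> l; apply/measurable_EFinP.
    by apply: measurable_indic; exact: measurableI.
  have pairE l : (\int[P]_w (\1_(X i @^-1` [set j] `&` X l @^-1` [set j]) w)%:E =
      P (X i @^-1` [set j] `&` X l @^-1` [set j]))%E.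
    by rewrite integral_indic//; [rewrite setIT | exact: measurableI].
  rewrite (bigD1 i)//= EFinD; apply: leeD; first by rewrite pairE setIid iid_pmf_atom.
  (* The n - 1 off-diagonal terms are completed to n equal ones, which only enlarges the bound. *)
  apply: (@le_trans _ _ (\sum_(l < n) (p0 j ^+ 2)%:E)%E); last first.
    by rewrite sumEFin sumr_const card_ord mulr_natl.
  rewrite [leRHS](bigD1 i)//= -[leLHS]add0e; apply: leeD.
    by rewrite lee_fin sqr_ge0.
  by apply: lee_sum => l li; rewrite pairE iid_pmf_atom2// eq_sym.
rewrite sumEFin sumr_const card_ord lee_fin -[leLHS]mulr_natl; lra.
Qed.

Let integral_count n j : (\int[P]_w (count n j w)%:E = (n%:R * p0 j)%:E)%E.
Proof.
rewrite /count; under eq_integral do rewrite -sumEFin.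
rewrite ge0_integral_sum//; last 2 first.
- by move=> i; apply/measurable_EFinP; exact: measurable_ind.
- by move=> i w _; rewrite lee_fin.
rewrite (eq_bigr (fun=> (p0 j)%:E)) => [|i _].
  by rewrite sumEFin sumr_const card_ord mulr_natl.
under eq_integral do rewrite indE.
by rewrite integral_indic// setIT; exact: iid_pmf_atom.
Qed.

Lemma iid_pmf_ge0 j : 0 <= p0 j.
Proof. by rewrite -lee_fin -(iid_pmf_atom 0%N). Qed.

(* [(N - a)^2 + 2 a N = N^2 + a^2] with [a = n p0(j)] keeps every integrand
   nonnegative. *)
Lemma integral_sqr_emp_pmf_dev n j : (0 < n)%N ->
  (\int[P]_w ((emp_pmf X n w j - p0 j) ^+ 2)%:E <= (p0 j / n%:R)%:E)%E.
Proof.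
move=> n0; have nR : 0 < n%:R :> R by rewrite ltr0n.
have p00 := iid_pmf_ge0 j.
have a0 : 0 <= n%:R * p0 j by rewrite mulr_ge0.
have mcount : measurable_fun setT (count n j).
  by apply: measurable_sum => i; exact: measurable_ind.
have count0 w : 0 <= count n j w by rewrite sumr_ge0.
set I := (\int[P]_w ((emp_pmf X n w j - p0 j) ^+ 2)%:E)%E.
have : ((n%:R ^+ 2)%:E * I + (2 * (n%:R * p0 j))%:E * (n%:R * p0 j)%:E =
    \int[P]_w (count n j w ^+ 2)%:E + ((n%:R * p0 j) ^+ 2)%:E)%E.
  have mdev2 : measurable_fun setT (fun w => ((emp_pmf X n w j - p0 j) ^+ 2)%:E).
    by apply/measurable_EFinP; apply: measurable_funX; exact: measurable_dev.
  have mcountE : measurable_fun setT (fun w => (count n j w)%:E).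
    exact/measurable_EFinP.
  have dev20 w : setT w -> (0 <= ((emp_pmf X n w j - p0 j) ^+ 2)%:E)%E.
    by rewrite lee_fin sqr_ge0.
  have countE0 w : setT w -> (0 <= (count n j w)%:E)%E by rewrite lee_fin.
  have a20 : 0 <= 2 * (n%:R * p0 j) by rewrite mulr_ge0.
  rewrite -integral_count -(ge0_integralZl_EFin P measurableT dev20 mdev2) ?sqr_ge0//.
  rewrite -ge0_integralZl_EFin//.
  rewrite -ge0_integralD//; last 4 first.
  - by move=> w _; rewrite -EFinM lee_fin mulr_ge0// sqr_ge0.
  - exact: measurable_funeM.
  - by move=> w _; rewrite mule_ge0 ?lee_fin.
  - exact: measurable_funeM.
  have -> : ((n%:R * p0 j) ^+ 2)%:E = (\int[P]_w (cst ((n%:R * p0 j) ^+ 2) w)%:E)%E.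
    by rewrite /= integral_cst// -[LHS]mule1; congr (_ * _)%E; apply/esym; exact: probability_setT.
  rewrite -ge0_integralD//; last 4 first.
  - by move=> w _; rewrite lee_fin sqr_ge0.
  - by apply/measurable_EFinP; apply: measurable_funX.
  - by move=> w _; rewrite lee_fin sqr_ge0.
  - exact/measurable_EFinP.
  apply: eq_integral => w _ /=; rewrite -!EFinM -!EFinD; congr EFin.
  rewrite /emp_pmf -/(count n j w); field; exact: lt0r_neq0.
move: (integral_sqr_count n j).
have I0 : (0 <= I)%E by apply: integral_ge0 => w _; rewrite lee_fin sqr_ge0.
move=> /(leeD2r ((n%:R * p0 j) ^+ 2)%:E) + E; rewrite -{}E.
(* An infinite integral is excluded because the right-hand side is finite. *)
case: I I0 => [x|_|//]; last by rewrite mulry gtr0_sg ?exprn_gt0// mul1e.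
rewrite -!EFinM -!EFinD !lee_fin => x0 H.
(* With a = n p0(j), the inequality n^2 x + 2 a^2 <= a + 2 a^2 leaves n x <= p0(j). *)
rewrite ler_pdivlMr// -(ler_pM2l nR); nra.
Qed.

Definition sqr_dist n w : \bar R :=
  (\sum_(j <oo) ((emp_pmf X n w j - p0 j) ^+ 2)%:E)%E.

Lemma measurable_sqr_dist n : measurable_fun setT (sqr_dist n).
Proof.
rewrite (_ : sqr_dist n = fun w => \sum_(j <oo | j \in xpredT)
  ((emp_pmf X n w j - p0 j) ^+ 2)%:E)%E; last first.
  by apply/funext => w; apply: eq_eseriesl.
apply: ge0_emeasurable_sum => [j w _ _|j _]; first by rewrite lee_fin sqr_ge0.
by apply/measurable_EFinP; apply: measurable_funX; exact: measurable_dev.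
Qed.

(** Tonelli's theorem: the coordinatewise bounds p0(j) / n add up to 1 / n. *)
Lemma integral_sqr_dist n : (0 < n)%N ->
  (\sum_(j <oo) (p0 j)%:E = 1)%E ->
  (\int[P]_w sqr_dist n w <= (n%:R^-1)%:E)%E.
Proof.
move=> n0 p1; rewrite integral_nneseries//; first last.
- by move=> j w _; rewrite lee_fin sqr_ge0.
- by move=> j; apply/measurable_EFinP; apply: measurable_funX; exact: measurable_dev.
apply: (@le_trans _ _ (\sum_(j <oo) ((n%:R^-1)%:E * (p0 j)%:E))%E).
  apply: lee_nneseries => [j _ _|j _].
    by apply: integral_ge0 => w _; rewrite lee_fin sqr_ge0.
  by rewrite -EFinM mulrC; exact: integral_sqr_emp_pmf_dev.
by rewrite nneseriesZl ?p1 ?mule1// => j _; rewrite lee_fin iid_pmf_ge0.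
Qed.

(** The level 1 / (n eps) is the one at which Markov's bound equals [eps]. *)
Lemma sqr_dist_markov n (eps : R) : (0 < n)%N -> 0 < eps ->
  (\sum_(j <oo) (p0 j)%:E = 1)%E ->
  measurable [set w | ((n%:R * eps)^-1)%:E <= sqr_dist n w]%E /\
  (P [set w | ((n%:R * eps)^-1)%:E <= sqr_dist n w] <= eps%:E)%E.
Proof.
move=> n0 e0 p1; have ne0 : 0 < n%:R * eps by rewrite mulr_gt0// ltr0n.
have sd0 w : (0 <= sqr_dist n w)%E by apply: nneseries_EFin_ge0 => j; exact: sqr_ge0.
split.
  rewrite -[X in measurable X]setTI.
  by apply: emeasurable_fun_c_infty => //; exact: measurable_sqr_dist.
have := le_integral_abse P measurableT (measurable_sqr_dist n)
  (a := (n%:R * eps)^-1).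
rewrite invr_gt0 => /(_ ne0); rewrite setTI.
have -> : [set x | (((n%:R * eps)^-1)%:E <= `|sqr_dist n x|)%E] =
          [set w | (((n%:R * eps)^-1)%:E <= sqr_dist n w)%E].
  by apply/seteqP; split => w /=; rewrite gee0_abs.
under eq_integral do rewrite gee0_abs//.
move=> /le_trans /(_ (integral_sqr_dist n0 p1)).
by rewrite lee_pdivrMl// -EFinM mulrAC divff ?mul1r// pnatr_eq0 -lt0n.
Qed.

(** A countable union of null atoms; off it, every observation is at most [S]. *)
Lemma negligible_outside_support S : (forall j, (S < j)%N -> p0 j = 0) ->
  measurable (\bigcup_i \bigcup_(j in [set j | (S < j)%N]) X i @^-1` [set j]) /\
  P (\bigcup_i \bigcup_(j in [set j | (S < j)%N]) X i @^-1` [set j]) = 0%E.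
Proof.
move=> p0S.
have mB i : measurable (\bigcup_(j in [set j | (S < j)%N]) X i @^-1` [set j]).
  by apply: bigcup_measurable.
have mBB : measurable (\bigcup_i \bigcup_(j in [set j | (S < j)%N]) X i @^-1` [set j]).
  by apply: bigcupT_measurable.
split=> //; apply: measure_negligible => //; apply: negligible_bigcup => i.
rewrite bigcup_mkcond; apply: negligible_bigcup => j.
apply/negligibleP; first by case: ifP.
case: ifPn; last by rewrite measure0.
by rewrite inE /= => Sj; rewrite iid_pmf_atom p0S.
Qed.

End EmpiricalPmf.

(** * From the squared distance to root-n rates *)

Section RootN.
Context {R : realType}.

Lemma convex_pmf_in_C (p0 : nat -> R) : convex_pmf p0 -> in_C p0.
Proof.
move=> [p00 [p1 [cp0 _]]]; split=> //.
apply: (@le_lt_trans _ _ 1%E); last exact: ltry.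
rewrite -p1; apply: le_nneseries_EFin => k.
have p0k1 : p0 k <= 1 by rewrite -lee_fin -p1 nneseries_EFin_term_le.
by rewrite sqr_ge0/= expr2 ler_piMl.
Qed.

(** Each coordinate is bounded by the l2 norm, and [ph] is at least as close to [q] as [p0] is. The
    factor 2 is the triangle inequality through [q]. *)
Lemma lse_sup_dist (q ph p0 : nat -> R) (a : R) k : is_lse q ph -> in_C p0 ->
  (\sum_(j <oo) ((q j - p0 j) ^+ 2)%:E < a%:E)%E ->
  `|ph k - p0 k| <= 2 * Num.sqrt a.
Proof.
move=> lse Cp0 qp0.
have sqrt_bnd u : (\sum_(j <oo) ((q j - u j) ^+ 2)%:E < a%:E)%E ->
    `|q k - u k| <= Num.sqrt a.
  move=> /(le_lt_trans (nneseries_EFin_term_le k (fun j => sqr_ge0 (q j - u j)))).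
  by rewrite lte_fin => /ltW/ler_wsqrtr; rewrite sqrtr_sqr.
have := sqrt_bnd _ qp0.
have := sqrt_bnd _ (le_lt_trans (lse_sum_le lse Cp0) qp0).
have -> : ph k - p0 k = - (q k - ph k) + (q k - p0 k) by ring.
have := ler_normD (- (q k - ph k)) (q k - p0 k); rewrite normrN; lra.
Qed.

Lemma emp_pmf_ge0 (T : Type) (X : nat -> T -> nat) n w j :
  0 <= emp_pmf X n w j :> R.
Proof. by rewrite mulr_ge0 ?invr_ge0// sumr_ge0. Qed.

Lemma emp_pmf_support (T : Type) (X : nat -> T -> nat) n w S :
  (forall i, (X i w <= S)%N) ->
  forall j, (S < j)%N -> emp_pmf X n w j = 0 :> R.
Proof.
move=> XS j Sj; rewrite /emp_pmf big1 ?mul0r// => i _.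
by rewrite ltn_eqF// (leq_ltn_trans (XS i)).
Qed.

Lemma Fcdf_emp_pmf (T : Type) (X : nat -> T -> nat) n w S : (0 < n)%N ->
  (forall i, (X i w <= S)%N) -> Fcdf (emp_pmf X n w) S = 1 :> R.
Proof.
move=> n0 XS; rewrite /Fcdf /emp_pmf -mulr_suml exchange_big/=.
rewrite (eq_bigr (fun=> 1)) => [|i _].
  by rewrite sumr_const card_ord divff// pnatr_eq0 -lt0n.
rewrite big_mkord (bigD1 (Ordinal (XS i : (X i w < S.+1)%N)))//= eqxx.
rewrite big1 ?addr0// => j; rewrite -val_eqE /= eq_sym.
by move=> /negbTE ->.
Qed.

Lemma convex_pmf_Fcdf (p0 : nat -> R) S : convex_pmf p0 ->
  (forall j, (S < j)%N -> p0 j = 0) -> Fcdf p0 S = 1.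
Proof.
move=> [p00 [+ _]] p0S; rewrite (nneseries_split 0 S.+1); last first.
  by move=> k _; rewrite lee_fin.
rewrite add0n eseries0 ?adde0; last by move=> j Sj _; rewrite p0S.
by rewrite sumEFin => -[].
Qed.

Lemma Op1_sup_of_bounded d (T : measurableType d) (P : probability T R)
    (Z : nat -> T -> nat -> R) :
  (forall eps : R, 0 < eps -> exists M N, forall n, (N <= n)%N ->
    exists A, [/\ measurable A, (P A <= eps%:E)%E &
      forall w, ~ A w -> forall k, `|Z n w k| <= M]) ->
  Op1_sup P Z.
Proof.
move=> H eps /H [M [N HN]]; exists M, N => n /HN [A [mA PA AZ]].
exists A; split=> //; split=> // w /= [k]; apply: contraPP => /AZ /(_ k) Zk.
by rewrite ltNge Zk.
Qed.

Lemma sqrtn_mul_sqrt_inv n (eps : R) : (0 < n)%N ->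
  Num.sqrt n%:R * (2 * Num.sqrt (n%:R * eps)^-1) = 2 * Num.sqrt eps^-1.
Proof.
move=> n0; rewrite mulrCA -sqrtrM// invfM mulrA divff ?mul1r//.
by rewrite pnatr_eq0 -lt0n.
Qed.

End RootN.

Theorem theorem1 (R : realType) (d : measure_display) (T : measurableType d)
  (P : probability T R) (p0 : nat -> R) (X : nat -> T -> nat)
  (phat : nat -> T -> nat -> R) :
  convex_pmf p0 ->
  iid_pmf P X p0 ->
  (forall n w, (0 < n)%N -> is_lse (emp_pmf X n w) (phat n w)) ->
  Op1_sup P (fun n w k => Num.sqrt (n%:R) * (phat n w k - p0 k)) /\
  ((exists S : nat, forall j, (S < j)%N -> p0 j = 0) ->
     Op1_sup P (fun n w k => Num.sqrt (n%:R) * (Fcdf (phat n w) k - Fcdf p0 k)) /\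
     Op1_sup P (fun n w z => Num.sqrt (n%:R) * (Hcum (phat n w) z - Hcum p0 z))).
Proof.
move=> cp0 iidX lse; have p1 := cp0.2.1.
have far n w (eps : R) k : (0 < n)%N ->
    ~ [set w | ((n%:R * eps)^-1)%:E <= sqr_dist X p0 n w]%E w ->
    `|phat n w k - p0 k| <= 2 * Num.sqrt (n%:R * eps)^-1.
  move=> n0 /negP; rewrite -ltNge => close.
  exact: lse_sup_dist (lse n w n0) (convex_pmf_in_C cp0) close.
have scale n (K x eps : R) : (0 < n)%N ->
    `|x| <= K * (2 * Num.sqrt (n%:R * eps)^-1) ->
    `|Num.sqrt n%:R * x| <= K * (2 * Num.sqrt eps^-1).
  move=> n0 xK; rewrite normrM ger0_norm ?sqrtr_ge0// -(sqrtn_mul_sqrt_inv eps n0).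
  by rewrite mulrCA ler_wpM2l ?sqrtr_ge0.
split.
  apply: Op1_sup_of_bounded => eps e0.
  exists (1 * (2 * Num.sqrt eps^-1)), 1%N => n n0.
  have [mA PA] := sqr_dist_markov iidX n0 e0 p1.
  exists [set w | ((n%:R * eps)^-1)%:E <= sqr_dist X p0 n w]%E; split=> // w Aw k.
  by apply: (scale _ _ _ _ n0); rewrite mul1r; exact: (far n w eps k n0 Aw).
move=> [S' p0S'].
(* Finite support rules out full support, so the support is exactly {0..S} and p0(S) > 0. *)
have [S [S0 p0S]] : exists S, (1 <= S)%N /\ forall j, p0 j != 0 <-> (j <= S)%N.
  case: cp0.2.2.2 => [/(_ S'.+1)|//]; by rewrite p0S' ?eqxx.
have p0z j : (S < j)%N -> p0 j = 0.
  by rewrite ltnNge => Sj; apply/eqP; apply: contraNT Sj => /p0S.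
have p0Spos : 0 < p0 S by rewrite lt_def (cp0.1 S) andbT; apply/p0S.
have [mB PB] := negligible_outside_support iidX p0z.
set B := (X in P X = _) in mB PB.
suff key (eps : R) : 0 < eps -> exists N, forall n, (N <= n)%N ->
    exists A, [/\ measurable A, (P A <= eps%:E)%E & forall w, ~ A w ->
      (forall k, `|Num.sqrt n%:R * (Fcdf (phat n w) k - Fcdf p0 k)| <=
        (S + 3)%:R * (2 * Num.sqrt eps^-1)) /\
      (forall z, `|Num.sqrt n%:R * (Hcum (phat n w) z - Hcum p0 z)| <=
        (S + 3)%:R * (S + 3)%:R * (2 * Num.sqrt eps^-1))].
  split; apply: Op1_sup_of_bounded => eps /key [N HN].
    exists ((S + 3)%:R * (2 * Num.sqrt eps^-1)), N => n /HN [A [mA PA H]].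
    by exists A; split=> // w /H[].
  exists ((S + 3)%:R * (S + 3)%:R * (2 * Num.sqrt eps^-1)), N => n /HN [A [mA PA H]].
  by exists A; split=> // w /H[].
(* For such n, 1 / (n eps) <= (p0(S) / 8)^2, so the uniform error 2 sqrt(1 / (n eps)) is at most
   p0(S) / 4, as the stability bound requires. *)
move=> e0; exists (Num.trunc (((p0 S / 8) ^+ 2 * eps)^-1)).+1 => n Nn.
have n0 : (0 < n)%N by apply: leq_trans Nn.
have small : 2 * Num.sqrt (n%:R * eps)^-1 <= p0 S / 4.
  have c0 : 0 < p0 S / 8 by rewrite divr_gt0.
  have : Num.sqrt (n%:R * eps)^-1 <= p0 S / 8.
    rewrite -[leRHS]ger0_norm ?(ltW c0)// -sqrtr_sqr ler_wsqrtr//.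
    have : ((p0 S / 8) ^+ 2 * eps)^-1 <= n%:R.
      by rewrite (le_trans (ltW (truncnS_gt _)))// ler_nat.
    rewrite invf_ple ?posrE ?ltr0n ?mulr_gt0 ?exprn_gt0// => H.
    by rewrite invfM ler_pdivrMr.
  lra.
have [mA PA] := sqr_dist_markov iidX n0 e0 p1.
(* The null set [B], on which some observation exceeds [S], joins the Markov event at no cost in
   probability. *)
exists ([set w | ((n%:R * eps)^-1)%:E <= sqr_dist X p0 n w]%E `|` B).
split; [exact: measurableU | by rewrite measureU0 | move=> w /not_orP[Aw Bw]].
have XS i : (X i w <= S)%N.
  by rewrite leqNgt; apply/negP => SX; apply: Bw; exists i => //; exists (X i w).
have [HF HH] := finite_support_stability (lse n w n0) cp0.2.2.1 S0 p0Spos p0z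
  (emp_pmf_ge0 X n w) (emp_pmf_support n XS)
  (etrans (Fcdf_emp_pmf n0 XS) (esym (convex_pmf_Fcdf cp0 p0z)))
  (fun k => far n w eps k n0 Aw) small.
split=> [k|z]; first exact: (scale _ _ _ _ n0 (HF k)).
by apply: (scale _ _ _ _ n0); rewrite -mulrA; exact: HH.
Qed.
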